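(* Let $S_1:[0,1]^2\to[0,1]$ be a continuous cancellative t-subnorm with additive generator $s_1:[0,1]\to[s_1(1),\infty]$ (normalized, i.e. $s_1(1)=1$, if $S_1$ is proper), and let $S_2:[0,1]^2\to[0,1]$ be a continuous cancellative t-norm with additive generator $s_2:[0,1]\to[0,\infty]$. If the function $x\mapsto\frac{s_1\circ s_2^{-1}(x)}{x}$ is non-increasing and bounded on $(0,\infty)$, then (i) $S_1\le S_2$ (pointwise on $[0,1]^2$); and (ii) $Ax\le s_1\circ s_2^{-1}(x)\le Bx$ for all $x\in(0,\infty)$, where $A=\displaystyle\lim_{x\to\infty}\frac{s_1\circ s_2^{-1}(x)}{x}$ and $B=\displaystyle\lim_{x\to0^+}\frac{s_1\circ s_2^{-1}(x)}{x}$.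
   Context: A t-subnorm is a binary operation $S:[0,1]^2\to[0,1]$ that is commutative, associative, non-decreasing in both variables and satisfies $S(x,y)\le\min(x,y)$. It is cancellative if $S(x,y)=S(x,z)$ with $x>0$ implies $y=z$. A t-norm is a t-subnorm having $1$ as neutral element; a t-subnorm that is not a t-norm is called proper. By a known representation theorem, a t-subnorm $S$ is continuous and cancellative if and only if there is a continuous, strictly decreasing function $s:[0,1]\to[0,\infty]$ with $s(0)=\infty$ such that $S(x,y)=s^{-1}(s(x)+s(y))$ for all $x,y\in[0,1]$, where $s$ is viewed as a bijection $[0,1]\to[s(1),\infty]$ with inverse $s^{-1}$. Such an $s$ is called an additive generator of $S$; it is unique up to a positive multiplicative constant; $S$ is a (strict) t-norm iff $s(1)=0$ and proper iff $s(1)>0$. When $S$ is proper, its normalized additive generator is the one with $s(1)=1$. *)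

(* Defs.v *)
From HB Require Import structures.
From mathcomp Require Import all_boot all_order all_algebra.
From mathcomp Require Import all_classical all_reals all_analysis.

Set Implicit Arguments.
Unset Strict Implicit.
Unset Printing Implicit Defensive.

Import Order.TTheory GRing.Theory Num.Theory.
Import numFieldNormedType.Exports.

Local Open Scope classical_set_scope.
Local Open Scope ring_scope.

(* Operations on [0,1] are represented by total functions R -> R -> R (and
   generators by total functions R -> \bar R) of which only the values at
   arguments in [0,1] are ever constrained or used. *)

Definition tsubnorm (R : realType) (S : R -> R -> R) : Prop :=
  [/\ forall x y, x \in `[0, 1] -> y \in `[0, 1] -> S x y \in `[0, 1],
      forall x y, x \in `[0, 1] -> y \in `[0, 1] -> S x y = S y x,
      forall x y z, x \in `[0, 1] -> y \in `[0, 1] -> z \in `[0, 1] ->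
        S x (S y z) = S (S x y) z,
      forall x x' y y', x \in `[0, 1] -> x' \in `[0, 1] ->
        y \in `[0, 1] -> y' \in `[0, 1] ->
        x <= x' -> y <= y' -> S x y <= S x' y' &
      forall x y, x \in `[0, 1] -> y \in `[0, 1] -> S x y <= Num.min x y].

Definition tnorm (R : realType) (S : R -> R -> R) : Prop :=
  tsubnorm S /\ forall x, x \in `[0, 1] -> S x 1 = x /\ S 1 x = x.

Definition proper_tsubnorm (R : realType) (S : R -> R -> R) : Prop :=
  tsubnorm S /\ ~ tnorm S.

Definition cancellative (R : realType) (S : R -> R -> R) : Prop :=
  forall x y z, x \in `[0, 1] -> y \in `[0, 1] -> z \in `[0, 1] ->
    S x y = S x z -> 0 < x -> y = z.

Definition continuous_op (R : realType) (S : R -> R -> R) : Prop :=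
  {within `[0, 1] `*` `[0, 1], continuous (fun p : R * R => S p.1 p.2)}.

(* Inverse of the restriction of s to [0,1]; it is meaningful on the image
   s([0,1]), which for a generator is [s 1, +oo]. *)
Definition gen_inv (R : realType) (s : R -> \bar R) : \bar R -> R :=
  'pinv_(fun=> 0) `[0, 1] s.

Definition additive_generator (R : realType) (S : R -> R -> R)
    (s : R -> \bar R) : Prop :=
  [/\ {within `[0, 1], continuous s},
      forall x, x \in `[0, 1] -> (0%:E <= s x)%E,
      forall x y, x \in `[0, 1] -> y \in `[0, 1] -> x < y -> (s y < s x)%E,
      s 0 = +oo%E &
      forall x y, x \in `[0, 1] -> y \in `[0, 1] ->
        S x y = gen_inv s (s x + s y)%E].

Definition gen_comp (R : realType) (s1 s2 : R -> \bar R) (x : R) : \bar R :=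
  s1 (gen_inv s2 x%:E).

Definition gen_ratio (R : realType) (s1 s2 : R -> \bar R) (x : R) : \bar R :=
  (gen_comp s1 s2 x / x%:E)%E.

(* Main.v *)
(* Outside its range a generator s has inverse value 0, while S x y > 0 for
   x, y > 0 by cancellativity; hence s x + s y lies in the range of s, and
   s (S x y) = s x + s y. Since h := s1 o s2^-1 has h(t)/t non-increasing, it is
   subadditive; at s2 x and s2 y this reads s1 (S2 x y) <= s1 (S1 x y). *)
Require Import Defs.
From HB Require Import structures.
From mathcomp Require Import all_boot all_order all_algebra.
From mathcomp Require Import all_classical all_reals all_analysis.

Import Order.TTheory GRing.Theory Num.Theory.
Import numFieldNormedType.Exports.

Local Open Scope classical_set_scope.
Local Open Scope ring_scope.

Lemma gen_inv_notin {R : realType} {s : R -> \bar R} {y : \bar R} :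
  ~ (s @` `[0, 1]) y -> gen_inv s y = 0.
Proof.
by move=> yN; rewrite /gen_inv /pinv_ splitV oinv_surj; case: pselect.
Qed.

(** A nonzero value cannot be the default, so it certifies that [y] lies in the range of [s]. The
    value 0 is inconclusive: for a generator it is also the inverse of [+oo]. *)
Lemma gen_inv_neq0K {R : realType} (s : R -> \bar R) (y : \bar R) :
  gen_inv s y != 0 -> s (gen_inv s y) = y.
Proof.
move=> y0; apply: pinvK; rewrite inE; apply: contrapT => /gen_inv_notin yE.
by rewrite yE eqxx in y0.
Qed.

Section Generator.
Context {R : realType} {S : R -> R -> R} {s : R -> \bar R}.

Lemma generatorK : additive_generator S s ->
  {in `[0, 1]%R, cancel s (gen_inv s)}.
Proof.
case=> _ _ sdec _ _ x x01; apply: pinvKV; last by rewrite inE.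
move=> {x01}x y; rewrite !inE /= => x01 y01 sxy.
by case: (ltgtP x y) => // xy; [have := sdec _ _ x01 y01 xy|
  have := sdec _ _ y01 x01 xy]; rewrite sxy ltxx.
Qed.

Lemma generator_le {x y} : additive_generator S s ->
  x \in `[0, 1] -> y \in `[0, 1] -> (s x <= s y)%E -> y <= x.
Proof.
case=> _ _ sdec _ _ x01 y01; apply: contraTT; rewrite -ltNge -ltNge => xy.
exact: sdec.
Qed.

Lemma generator_fin_num {x} : additive_generator S s ->
  x \in `[0, 1] -> 0 < x -> s x \is a fin_num.
Proof.
case=> _ s0 sdec soo _ x01 xgt0; rewrite ge0_fin_numE; last exact: s0.
by rewrite -soo; apply: sdec => //; rewrite in_itv/= lexx ler01.
Qed.

(** Neutrality gives [S 1 1 = 1], a nonzero inverse value, so [s 1 + s 1] is in the range and equals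
    [s 1]; finiteness of [s 1] permits cancelling. *)
Lemma generator_tnorm1 : tnorm S -> additive_generator S s -> s 1 = 0%:E.
Proof.
move=> [_ S1] sS; have I1 : (1 : R) \in `[0, 1] by rewrite in_itv/= ler01 lexx.
have sS11 : gen_inv s (s 1 + s 1)%E = 1.
  by have [_ _ _ _ <-] := sS; have [] := S1 _ I1.
have := gen_inv_neq0K s (s 1 + s 1)%E; rewrite sS11 => /(_ (oner_neq0 _)).
rewrite -[s 1](fineK (generator_fin_num sS I1 ltr01)) => -[/eqP].
by rewrite -subr_eq0 opprD addNKr oppr_eq0 => /eqP ->.
Qed.

(** The bound by the minimum forces [S x 0 = 0]; were [S x y] zero too, cancelling [x] would give
    [y = 0]. *)
Lemma cancellative_gt0 {x y} : tsubnorm S -> cancellative S ->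
  x \in `[0, 1] -> y \in `[0, 1] -> 0 < x -> 0 < y -> 0 < S x y.
Proof.
move=> [S01 _ _ _ Smin] Sc x01 y01 x0 y0.
have S_ge0 u v : u \in `[0, 1] -> v \in `[0, 1] -> 0 <= S u v.
  by move=> u01 v01; have := S01 _ _ u01 v01; rewrite in_itv => /andP[].
have I0 : (0 : R) \in `[0, 1] by rewrite in_itv/= ler01 lexx.
have Sx0 : S x 0 = 0.
  apply/eqP; rewrite eq_le S_ge0// andbT (le_trans (Smin _ _ x01 I0))//.
  by rewrite ge_min lexx orbT.
rewrite lt_neqAle S_ge0// andbT; apply: contraTneq y0 => Sxy.
by rewrite -leNgt (Sc x y 0)// Sx0.
Qed.

Lemma generatorD {x y} : tsubnorm S -> cancellative S -> additive_generator S s ->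
  x \in `[0, 1] -> y \in `[0, 1] -> 0 < x -> 0 < y ->
  s (S x y) = (s x + s y)%E.
Proof.
move=> St Sc [_ _ _ _ SE] x01 y01 x0 y0.
have := cancellative_gt0 St Sc x01 y01 x0 y0; rewrite SE// => /lt0r_neq0.
exact: gen_inv_neq0K.
Qed.

End Generator.

(** With q = h(a+b)/(a+b), monotonicity gives q a <= h(a) and q b <= h(b); the sum of the left sides
    is h(a+b). *)
Lemma nonincreasing_ratio_subadd {R : realType} {h : R -> \bar R} {a b : R} :
  (forall x y : R, 0 < x -> x <= y -> (h y / y%:E <= h x / x%:E)%E) ->
  0 < a -> 0 < b -> (h (a + b)%R <= h a + h b)%E.
Proof.
move=> hr a0 b0; have ab0 : 0 < a + b by rewrite addr_gt0.
have := hr b (a + b) b0; have := hr a (a + b) a0.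
rewrite lerDl (ltW b0) lerDr (ltW a0) => /(_ isT) + /(_ isT).
rewrite !inver !gt_eqF// !lee_pdivlMr// => ha hb.
(* Distributivity in [\bar R] is justified by the signs of [a] and [b]. *)
apply: le_trans (leeD ha hb); rewrite -ge0_muleDr ?lee_fin ?(ltW a0) ?(ltW b0)//.
by rewrite -EFinD -lee_pdivrMr.
Qed.

(** Monotonicity makes the two limits an infimum and a supremum, which bracket [f]; the bound [M]
    makes them finite. *)
Lemma nonincreasing_bounded_cvge {R : realType} {f : R -> \bar R} {M : R} :
  (forall x y : R, 0 < x -> x <= y -> (f y <= f x)%E) ->
  (forall x : R, 0 < x -> (`|f x| <= M%:E)%E) ->
  exists A B : R, [/\ f x @[x --> +oo] --> A%:E, f x @[x --> 0^'+] --> B%:E &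
    forall x : R, 0 < x -> (A%:E <= f x)%E /\ (f x <= B%:E)%E].
Proof.
move=> fdec fM.
have fMP x : 0 < x -> ((- M)%:E <= f x)%E /\ (f x <= M%:E)%E.
  by move=> /fM; case: (f x) => //= r; rewrite !lee_fin ler_norml => /andP.
have fin (l : \bar R) : ((- M)%:E <= l)%E -> (l <= M%:E)%E -> l = (fine l)%:E.
  move=> lM Ml; rewrite fineK// fin_numE.
  by rewrite -ltey -ltNye (lt_le_trans _ lM) ?ltNyr// (le_lt_trans Ml) ?ltry.
(* Since [f] is monotone only on positive arguments, truncating at 1 yields a function monotone on
   all of [R] with the same germ at [+oo]. *)
have foo : f x @[x --> +oo] --> ereal_inf (range (fun x => f (Num.max x 1))).
  have /nonincreasing_cvge :
      {homo (fun x => f (Num.max x 1)) : x y / x <= y >-> (y <= x)%E}.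
    move=> x y xy; apply: fdec; first by rewrite lt_max ltr01 orbT.
    by rewrite ge_max !le_max xy lexx !orbT.
  apply: cvg_trans; apply: near_eq_cvg; near=> x.
  by rewrite max_l//; near: x; exact: nbhs_pinfty_ge.
have f0 : f x @[x --> 0^'+] --> ereal_sup (f @` `]0, +oo[).
  apply: nonincreasing_at_right_cvge => // x y; rewrite !in_itv/= !andbT.
  by move=> x0 _; exact: fdec.
set A := ereal_inf _ in foo; set B := ereal_sup _ in f0.
(* The infimum sees only arguments at least 1, so for smaller [x] the bound is drawn from the
   limit. *)
have fA x : 0 < x -> (A <= f x)%E.
  move=> x0; apply: (cvge_to_le foo); near=> y; exact: fdec.
have fB x : 0 < x -> (f x <= B)%E.
  by move=> x0; apply: ereal_sup_ubound; exists x => //=; rewrite in_itv/= x0.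
have AE : A = (fine A)%:E.
  apply: fin; last by rewrite (le_trans (fA _ ltr01))//; case: (fMP _ ltr01).
  by apply: le_ereal_inf_tmp => _ [x _ <-]; apply: (fMP _ _).1; rewrite lt_max ltr01 orbT.
have BE : B = (fine B)%:E.
  apply: fin; first by rewrite (le_trans _ (fB _ ltr01))//; case: (fMP _ ltr01).
  by apply: ge_ereal_sup => _ [x /= + <-]; rewrite in_itv/= andbT => /fMP[].
exists (fine A), (fine B); rewrite -AE -BE; split=> // x x0.
by split; [exact: fA|exact: fB].
Unshelve. all: by end_near. Qed.

Theorem theorem4p2 (R : realType) (S1 S2 : R -> R -> R) (s1 s2 : R -> \bar R)
  (S1_tsubnorm : tsubnorm S1)
  (S1_continuous : continuous_op S1)
  (S1_cancellative : cancellative S1)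
  (s1_generator : additive_generator S1 s1)
  (s1_normalized : proper_tsubnorm S1 -> s1 1 = 1%:E)
  (S2_tnorm : tnorm S2)
  (S2_continuous : continuous_op S2)
  (S2_cancellative : cancellative S2)
  (s2_generator : additive_generator S2 s2)
  (ratio_nonincreasing : forall x y : R, 0 < x -> x <= y ->
     (gen_ratio s1 s2 y <= gen_ratio s1 s2 x)%E)
  (ratio_bounded : exists M : R, forall x : R, 0 < x ->
     (`|gen_ratio s1 s2 x| <= M%:E)%E) :
  (forall x y : R, x \in `[0, 1] -> y \in `[0, 1] -> S1 x y <= S2 x y) /\
  (exists A B : R,
     [/\ gen_ratio s1 s2 x @[x --> +oo] --> A%:E,
         gen_ratio s1 s2 x @[x --> 0^'+] --> B%:E &
         forall x : R, 0 < x ->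
           ((A * x)%:E <= gen_comp s1 s2 x)%E /\
           (gen_comp s1 s2 x <= (B * x)%:E)%E]).
Proof.
split; last first.
  have [M fM] := ratio_bounded.
  have [A [B [cA cB AB]]] := nonincreasing_bounded_cvge ratio_nonincreasing fM.
  exists A, B; split=> // x x0; have := AB x x0.
  by rewrite /gen_ratio inver gt_eqF// lee_pdivlMr// lee_pdivrMr// !EFinM.
move=> x y x01 y01.
have [S1_01 _ _ _ S1min] := S1_tsubnorm.
have [[S2_01 _ _ _ _] S2_1] := S2_tnorm; have S2t := S2_tnorm.1.
have le1 u v : u \in `[0, 1] -> v \in `[0, 1] -> S1 u v <= u /\ S1 u v <= v.
  by move=> u01 v01; have := S1min _ _ u01 v01; rewrite le_min => /andP[].
have [S1x S1y] := le1 _ _ x01 y01.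
have S2_ge0 : 0 <= S2 x y by have := S2_01 _ _ x01 y01; rewrite in_itv => /andP[].
have gt0_or0 (u : R) : u \in `[0, 1] -> u = 0 \/ 0 < u.
  by rewrite in_itv/= le_eqVlt => /andP[/orP[/eqP <-|]]; [left|right].
have [x_eq0|x0] := gt0_or0 _ x01; first by apply: (le_trans _ S2_ge0); rewrite -x_eq0.
have [y_eq0|y0] := gt0_or0 _ y01; first by apply: (le_trans _ S2_ge0); rewrite -y_eq0.
have I1 : (1 : R) \in `[0, 1] by rewrite in_itv/= ler01 lexx.
(* The ratio is controlled only on positive reals: [u > 0] makes [s2 u] finite, and [u < 1] makes it
   exceed [s2 1 = 0]. *)
have s2_gt0 u : u \in `[0, 1] -> 0 < u -> u <> 1 ->
    exists2 a : R, 0 < a & s2 u = a%:E.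
  move=> u01 u0 /eqP u1; have su := generator_fin_num s2_generator u01 u0.
  exists (fine (s2 u)); last by rewrite fineK.
  rewrite -lte_fin fineK// -(generator_tnorm1 S2_tnorm s2_generator).
  case: s2_generator => _ _ sdec _ _; apply: sdec => //.
  by rewrite lt_neqAle u1; move: u01; rewrite in_itv => /andP[].
(* An argument 1 has [s2 1 = 0], where the ratio says nothing; there [S2] returns the other
   argument, which bounds [S1]. *)
have [x1|/eqP x1] := eqVneq x 1; first by rewrite x1 in S1y *; rewrite (S2_1 _ y01).2.
have [y1|/eqP y1] := eqVneq y 1; first by rewrite y1 in S1x *; rewrite (S2_1 _ x01).1.
have [a a0 sx] := s2_gt0 _ x01 x0 x1; have [b b0 sy] := s2_gt0 _ y01 y0 y1.
have := nonincreasing_ratio_subadd ratio_nonincreasing a0 b0.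
(* Once [a + b] is written as [s2 (S2 x y)], [gen_inv s2] cancels in all three terms. *)
rewrite /gen_comp EFinD -sx -sy.
rewrite -(generatorD S2t S2_cancellative s2_generator x01 y01 x0 y0).
rewrite !(generatorK s2_generator)//; last exact: S2_01.
rewrite -(generatorD S1_tsubnorm S1_cancellative s1_generator x01 y01 x0 y0).
(* Strict decrease of [s1] reverses the inequality. *)
by apply: (generator_le s1_generator); [exact: S2_01|exact: S1_01].
Qed.
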